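(* For every convex polygon $C$ in the plane there is a constant $d$ such that the following holds. If there is an integer $m$ such that any finite set of points in the plane can be colored with two colors so that any homothetic copy of $C$ containing at least $m$ of the points contains points of both colors, then for every positive integer $k$ any finite set of points in the plane can be colored with $k$ colors so that any homothetic copy of $C$ containing at least $m_k=k^d$ of the points contains points of all $k$ colors.
   Context: A homothetic copy of a planar set $C$ is a set of the form $\lambda C+v$ with $\lambda>0$ and $v\in\mathbb R^2$. Polygons are closed regions. *)

(* Defs.v *)
From HB Require Import structures.
From mathcomp Require Import all_boot all_order all_algebra.
From mathcomp Require Import finmap.
From mathcomp Require Import all_classical all_reals all_analysis.

Set Implicit Arguments.
Unset Strict Implicit.
Unset Printing Implicit Defensive.

Import Order.TTheory GRing.Theory Num.Theory.
Import numFieldNormedType.Exports.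

Local Open Scope classical_set_scope.
Local Open Scope ring_scope.

Definition convex_hull (R : realType) (A : set 'rV[R]_2) : set 'rV[R]_2 :=
  smallest (fun B : set 'rV[R]_2 => convex_set B) A.

(* A convex polygon is a closed region: points and segments are excluded by
   the nonempty interior. *)
Definition convex_polygon (R : realType) (C : set 'rV[R]_2) : Prop :=
  (exists V : {fset 'rV[R]_2}, C = convex_hull [set` V]) /\ C° !=set0.

Definition homothetic_copy (R : realType) (C D : set 'rV[R]_2) : Prop :=
  exists (l : R) (v : 'rV[R]_2), 0 < l /\ D = [set l *: x + v | x in C].

(* Only the values of the coloring [c] on the finite set [S] matter. *)
Definition polychromatic_colorable (R : realType) (C : set 'rV[R]_2)
    (k m : nat) : Prop :=
  forall S : {fset 'rV[R]_2}, exists c : 'rV[R]_2 -> 'I_k,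
    forall D : set 'rV[R]_2, homothetic_copy C D ->
      (m <= #|` [fset p in S | p \in D]%fset|)%N ->
      forall i : 'I_k, exists p : 'rV[R]_2, [/\ p \in S, p \in D & c p = i].

(* Main.v *)
(* A finite point set in a convex polygon C that avoids n given points is
   covered by a number of copies of C inside C, depending on n and C only, that
   avoid the n points (Keszegh-Palvolgyi self-coverability).  Hence, given a
   k-coloring for threshold M and 2-colorings for threshold m, split every
   color class in two: a copy with fewer than m points of one class breaks up
   into boundedly many copies free of that class, each with fewer than M
   points.  So doubling the number of colors multiplies the threshold by a
   constant, which makes it polynomial in k.

   It suffices to cover C minus one point r.  If no copy with a vertex as
   center of homothety separates p from r, then the weights of p in any convex
   representation by vertices are at most maximal weights m_i, determined by r,
   whose sum is 1 + O(s), where s is the depth of r in C.  So these weights lie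
   in intervals of length O(s), and a bounded grid of copies of size proportional
   to s covers all such p, unless p is so close to r compared with s that it is
   covered by copies touching r along an edge. *)

Require Import Defs.
From mathcomp Require Import all_boot all_order all_algebra.
From mathcomp Require Import finmap.
From mathcomp Require Import all_classical all_reals all_analysis.
From mathcomp Require Import ring lra zify.

Set Implicit Arguments.
Unset Strict Implicit.
Unset Printing Implicit Defensive.

Import Order.TTheory GRing.Theory Num.Theory.
Import numFieldNormedType.Exports.

Local Open Scope classical_set_scope.
Local Open Scope ring_scope.

(** * Self-coverability under homotheties and iteration *)

(* Empty sets pad the family, so that [I] does not depend on [B] and [P]. *)
Definition self_coverable (R : realType) (C : set 'rV[R]_2) (I : finType)
    (n : nat) : Prop :=
  forall B P : seq 'rV[R]_2, (size B <= n)%N ->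
  (forall p, p \in P -> C p /\ p \notin B) ->
  exists D : I -> set 'rV[R]_2,
    [/\ forall i, D i `<=` C,
        forall i, D i = set0 \/ homothetic_copy C (D i),
        forall i p, p \in B -> ~ D i p
      & forall p, p \in P -> exists i, D i p].

Lemma homothetic_copy_refl (R : realType) (C : set 'rV[R]_2) :
  homothetic_copy C C.
Proof.
exists 1, 0; split => //; apply/seteqP; split => x.
  by move=> Cx; exists x => //; rewrite scale1r addr0.
by case=> y Cy <-; rewrite scale1r addr0.
Qed.

Lemma homothetic_copy_trans (R : realType) (C D F : set 'rV[R]_2) :
  homothetic_copy C D -> homothetic_copy D F -> homothetic_copy C F.
Proof.
move=> [l [v [l0 ->]]] [k [w [k0 ->]]].
exists (k * l), (k *: v + w); split; first exact: mulr_gt0.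
apply/seteqP; split => x.
  by case=> _ [y Cy <-] <-; exists y => //; rewrite scalerDr scalerA addrA.
case=> y Cy <-; exists (l *: y + v); first by exists y.
by rewrite scalerDr scalerA addrA.
Qed.

(** The homothety [f] from [C] to [F] and its inverse [g] carry the problem over, since [f] maps
    homothetic copies to homothetic copies. *)
Lemma self_coverable_copy (R : realType) (C F : set 'rV[R]_2) (I : finType)
    (n : nat) :
  self_coverable C I n -> homothetic_copy C F -> self_coverable F I n.
Proof.
move=> CI [l [v [l0 FE]]] B P Bn PF.
have l1 : l != 0 by rewrite gt_eqF.
pose f (x : 'rV[R]_2) : 'rV[R]_2 := l *: x + v.
pose g (x : 'rV[R]_2) : 'rV[R]_2 := l^-1 *: (x - v).
have fK : cancel f g by move=> x; rewrite /f /g addrK scalerA mulVf ?scale1r.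
have gK : cancel g f by move=> x; rewrite /f /g scalerA mulfV ?scale1r ?subrK.
have [] := CI [seq g x | x <- B] [seq g x | x <- P].
- by rewrite size_map.
- move=> _ /mapP[p /PF [Fp pB] ->]; split.
    by move: Fp; rewrite FE => -[y Cy <-]; rewrite -/(f y) fK.
  by rewrite mem_map //; exact: can_inj gK.
move=> D [DC Dcopy DB DP]; exists (fun i => f @` D i); split.
- by move=> i _ [x /DC Cx <-]; rewrite FE; exists x.
- move=> i; case: (Dcopy i) => [->|[k [w [k0 DE]]]]; [left|right].
    by rewrite image_set0.
  exists k, (f w - k *: v); split => //; rewrite DE FE.
  apply/seteqP; split => x.
    case=> _ [y Cy <-] <-; exists (f y); first by exists y.
    by apply/rowP => j; rewrite /f !mxE; ring.
  case=> _ [y Cy <-] <-; exists (k *: y + w); first by exists y.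
  by apply/rowP => j; rewrite /f !mxE; ring.
- move=> i p pB [x Dx fx]; apply: (DB i (g p)); first exact: map_f.
  by rewrite -fx fK.
- move=> p pP; have [i Di] := DP (g p) (map_f _ pP).
  by exists i, (g p) => //; rewrite gK.
Qed.

(* Covering by copies that avoid one point, and iterating inside each copy,
   costs a factor [#|I|] per avoided point. *)
Lemma self_coverable_iter (R : realType) (C : set 'rV[R]_2) (I : finType) :
  self_coverable C I 1 -> forall n, exists J : finType, self_coverable C J n.
Proof.
move=> CI; elim=> [|n [J CJ]].
  exists unit => B P; rewrite leqn0 => /nilP -> PC.
  exists (fun=> C); split => //.
  - by move=> _; exact: subset_refl.
  - by move=> _; right; exact: homothetic_copy_refl.
  - by move=> p /PC [Cp _]; exists tt.
(* [None] supplies an index when [B] is empty and [C] alone suffices; otherwise it indexes empty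
   sets. *)
exists (option I * J)%type => B P Bn PC.
case: B Bn PC => [_ PC|b B /=].
  exists (fun=> C); split => //.
  - by move=> _; exact: subset_refl.
  - by move=> _; right; exact: homothetic_copy_refl.
  - have [D [_ _ _ DP]] := CJ [::] P (leq0n n) PC.
    by move=> p /[dup] /PC [Cp _] /DP [j _]; exists (None, j).
rewrite ltnS => Bn PC.
have [|D [DC Dcopy Db DP]] := CI [:: b] P (leqnn 1).
  by move=> p /PC [Cp]; rewrite in_cons negb_or mem_seq1 => /andP[].
have /choice[E HE] : forall i, exists E : J -> set 'rV[R]_2,
    [/\ forall j, E j `<=` D i,
        forall j, E j = set0 \/ homothetic_copy C (E j),
        forall j p, p \in B -> ~ E j p
      & forall p, p \in P -> D i p -> exists j, E j p].
  move=> i; case: (Dcopy i) => [->|Dicopy].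
    by exists (fun=> set0); split=> [j x []|j|j p _ []|p _ []]; left.
  have /(_ B [seq p <- P | `[< D i p >]] Bn) := self_coverable_copy CJ Dicopy.
  case.
    move=> p; rewrite mem_filter => /andP[/asboolP Dip /PC [_]].
    by rewrite in_cons negb_or => /andP[].
  move=> E [ED Ecopy EB EP]; exists E; split => //.
    move=> j; case: (Ecopy j) => [|Ej]; [by left|right].
    exact: homothetic_copy_trans Dicopy Ej.
  by move=> p pP /asboolP Dp; apply: EP; rewrite mem_filter Dp.
exists (fun ij => if ij.1 is Some i then E i ij.2 else set0); split.
- move=> [[i|] j] /=; last by move=> x [].
  have [ED _ _ _] := HE i; exact: subset_trans (ED j) (DC i).
- by move=> [[i|] j] /=; [have [_ + _ _] := HE i|left].
- move=> [[i|] j] p /=; last by move=> _ [].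
  have [ED _ EB _] := HE i.
  rewrite in_cons => /orP[/eqP -> /ED|]; last exact: EB.
  by apply: Db; rewrite mem_head.
- move=> p pP; have [i Dp] := DP _ pP.
  by have [_ _ _ /(_ p pP Dp) [j Ep]] := HE i; exists (Some i, j).
Qed.

(** * Polychromatic colorings from self-coverability *)

Lemma polychromatic_colorable_leq (R : realType) (C : set 'rV[R]_2)
    (k m k' m' : nat) :
  (0 < k' <= k)%N -> (m <= m')%N ->
  polychromatic_colorable C k m -> polychromatic_colorable C k' m'.
Proof.
case: k' => // k' /= lekk lemm Ckm S; have [c Hc] := Ckm S.
(* [inord] sends the surplus colors to 0 and keeps the others. *)
exists (fun p => inord (c p)) => D DC /(leq_trans lemm) Dm i.
have [p [pS pD cp]] := Hc D DC Dm (widen_ord lekk i).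
by exists p; split => //; apply/val_inj; rewrite /= cp /= inordK.
Qed.

Lemma polychromatic_colorable1 (R : realType) (C : set 'rV[R]_2) :
  polychromatic_colorable C 1 1.
Proof.
move=> S; exists (fun=> ord0) => D _; rewrite cardfs_gt0 => /fset0Pn[p].
by rewrite !inE /= => /andP[pS pD] i; exists p; rewrite pS pD (ord1 i).
Qed.

Lemma size_le_sum_count (T : Type) (I : finType) (D : I -> pred T)
    (s : seq T) :
  all (fun x => [exists i, D i x]) s -> (size s <= \sum_i count (D i) s)%N.
Proof.
elim: s => //= x s IHs /andP[/existsP[i Dix] /IHs les].
rewrite big_split /= -add1n leq_add //.
by rewrite (bigD1 i) //= Dix.
Qed.

(* A copy with fewer than [m] points of some class of the [k]-coloring splits
   into [#|J|] copies free of that class, each with fewer than [M] points. *)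
Lemma polychromatic_colorable_double (R : realType) (C : set 'rV[R]_2)
    (J : finType) (k m M : nat) :
  self_coverable C J m -> (0 < M)%N -> polychromatic_colorable C k M ->
  polychromatic_colorable C 2 m ->
  polychromatic_colorable C (2 * k) ((#|J| + m) * M).
Proof.
move=> CJ M0 Ck C2 S; have [c Hc] := Ck S.
pose Sc i := [fset p in S | c p == i]%fset.
have /choice[b Hb] := fun i => C2 (Sc i).
have cbP p : (2 * c p + b (c p) p < 2 * k)%N.
  by have := ltn_ord (c p); have := ltn_ord (b (c p) p); lia.
(* The new color joins the old one with the bit given by the 2-coloring of its class. *)
exists (fun p => Ordinal (cbP p)) => D DC DN j.
have jk : (j %/ 2 < k)%N by have := ltn_ord j; lia.
pose i := Ordinal jk; pose j2 : 'I_2 := inord (j %% 2).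
have j2E : j2 = (j %% 2)%N :> nat by rewrite inordK // ltn_mod.
suff mSi : (m <= #|` [fset p in Sc i | p \in D]%fset|)%N.
  have [p [+ pD bp]] := Hb i D DC mSi j2.
  rewrite !inE /= => /andP[pS /eqP cp]; exists p; split => //.
  apply/val_inj => /=; rewrite cp bp j2E /=.
  by rewrite mulnC -divn_eq.
rewrite leqNgt; apply/negP => Sim.
pose Bs := [fset p in Sc i | p \in D]%fset.
pose P := [fset p in S | (p \in D) && (c p != i)]%fset.
have [||E [ED Ecopy EB EP]] :=
    self_coverable_copy CJ DC (B := enum_fset Bs) (P := enum_fset P).
- exact: ltnW.
- move=> p; rewrite -[p \in enum_fset P]/(p \in P) -[p \in enum_fset Bs]/(p \in Bs).
  rewrite !inE /= => /and3P[pS pD cp]; split; first exact: set_mem.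
  by rewrite (negPf cp) andbF.
(* [E q] avoids all points of color [i] in [D], so by the choice of [c] it cannot hold [M]
   points. *)
have cardE q : (#|` [fset p in S | p \in E q]%fset| < M)%N.
  rewrite ltnNge; apply/negP => ME.
  case: (Ecopy q) => [E0|Eq].
    move: (leq_trans M0 ME); rewrite cardfs_gt0 => /fset0Pn[p].
    by rewrite !inE /= E0 in_set0 andbF.
  have [p [pS /set_mem pE cp]] := Hc _ (homothetic_copy_trans DC Eq) ME i.
  apply: (EB q p) => //; rewrite -[p \in enum_fset Bs]/(p \in Bs) !inE /= pS cp eqxx.
  by apply/mem_set/ED; exact: pE.
have cardP : (#|` P| <= #|J| * M)%N.
  have /(@size_le_sum_count _ J (fun q p => `[< E q p >])) :
      all (fun p => [exists q, `[< E q p >]]) (enum_fset P).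
    by apply/allP => p /EP[q Ep]; apply/existsP; exists q; apply/asboolP.
  move=> /leq_trans; apply; rewrite -sum_nat_const leq_sum // => q _.
  rewrite -size_filter; apply: leq_trans (ltnW (cardE q)).
  rewrite uniq_leq_size ?filter_uniq ?fset_uniq // => p.
  rewrite mem_filter => /andP[/asboolP Ep].
  rewrite -[p \in enum_fset P]/(p \in P).
  rewrite -[X in _ -> is_true X]/(p \in [fset p in S | p \in E q]%fset).
  by rewrite !inE /= => /andP[-> _]; exact: mem_set.
move: DN; apply/negP; rewrite -ltnNge.
have -> : [fset p in S | p \in D]%fset = (P `|` Bs)%fset.
  apply/fsetP => p; rewrite !inE /=; case: (p \in S) => //=.
  by case: (p \in D) => //=; rewrite ?andbT ?andbF // orNb.
rewrite cardfsU; apply: leq_ltn_trans (leq_subr _ _) _.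
rewrite mulnDl -addnS leq_add //.
by apply: leq_trans Sim _; rewrite leq_pmulr.
Qed.

Lemma self_coverable_polychromatic (R : realType) (C : set 'rV[R]_2)
    (I : finType) :
  self_coverable C I 1 ->
  exists d : nat,
    (exists m : nat, polychromatic_colorable C 2 m) ->
    forall k : nat, (0 < k)%N -> polychromatic_colorable C k (k ^ d)%N.
Proof.
move=> CI.
(* The exponent depends on [m] but is asserted before any [m] is given, hence the excluded
   middle. *)
have [[m Cm]|noC] := pselect (exists m, polychromatic_colorable C 2 m);
  last by exists 0%N => /noC.
have [J CJ] := self_coverable_iter CI m.
(* The surplus 2 makes [up_log 2 A] positive, which cancelling exponents below requires. *)
pose A := (#|J| + m).+2.
have powA j : polychromatic_colorable C (2 ^ j) (A ^ j).
  elim: j => [|j IHj]; first exact: polychromatic_colorable1.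
  have := polychromatic_colorable_double CJ _ IHj Cm.
  rewrite !expnS expn_gt0 /= => /(_ isT).
  apply: polychromatic_colorable_leq; first by rewrite leqnn andbT muln_gt0 expn_gt0.
  by rewrite leq_mul2r ltnW ?orbT.
(* With [j = up_log 2 k] one has [k <= 2 ^ j <= k ^ 2], so [A ^ j] is at most
   [(2 ^ j) ^ up_log 2 A], hence at most [k ^ (2 * up_log 2 A)]. *)
exists (2 * up_log 2 A)%N => _ k; rewrite leq_eqVlt => /predU1P[<-|k1].
  by rewrite exp1n; exact: polychromatic_colorable1.
have kj := up_logP k (isT : (1 < 2)%N).
apply: polychromatic_colorable_leq (powA (up_log 2 k)); first by rewrite ltnW.
apply: (@leq_trans ((2 ^ up_log 2 A) ^ up_log 2 k)).
  by rewrite leq_exp2r ?up_logP // up_log_gt0.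
rewrite -expnM mulnC !expnM leq_exp2r ?up_log_gt0 //.
have [+ _] := andP (up_log_bounds (isT : (1 < 2)%N) k1).
have: (0 < up_log 2 k)%N by rewrite up_log_gt0.
case: (up_log 2 k) => // j _ /=; rewrite expnS => jk.
apply: (@leq_trans (2 * k)); first by rewrite leq_mul2l ltnW.
by rewrite -mulnn leq_mul2r k1 orbT.
Qed.

(** * Polyhedral cones by elimination *)

(** Including 0 covers the empty list, encodes the sign constraint on an eliminated weight, and
    later caps the depth of a point. *)
Lemma seq_max_attained (R : realType) (T : eqType) (s : seq T) (f : T -> R) :
  exists t, [/\ 0 <= t, forall x, x \in s -> f x <= t
    & t = 0 \/ exists2 x, x \in s & t = f x].
Proof.
elim: s => [|x s [t [t0 ht hs]]]; first by exists 0; split => //; left.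
have [xt|tx] := leP (f x) t.
  exists t; split => //.
    by move=> y; rewrite in_cons => /predU1P[->//|/ht].
  case: hs => [|[y ys ->]]; [by left|right].
  by exists y => //; rewrite in_cons ys orbT.
exists (f x); split; first exact: le_trans (ltW tx).
  by move=> y; rewrite in_cons => /predU1P[->//|/ht /le_trans]; apply; exact: ltW.
by right; exists x => //; rewrite mem_head.
Qed.

(* Fourier-Motzkin elimination of the weight of the first generator. *)
Lemma cone_polyhedral (R : realType) (d n : nat) (V : 'I_n -> 'rV[R]_d) :
  exists L : seq 'cV[R]_d, forall z : 'rV[R]_d,
    (exists2 w : 'I_n -> R, forall i, 0 <= w i & z = \sum_i w i *: V i) <->
    (forall l, l \in L -> 0 <= (z *m l) 0 0).
Proof.
elim: n V => [|n IHn] V.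
  (* Without generators the cone is the origin, cut out by the coordinates and their negatives. *)
  exists ([seq delta_mx i 0 | i <- enum 'I_d]
       ++ [seq - delta_mx i 0 | i <- enum 'I_d]) => z; split.
    by case=> w _ ->; rewrite big_ord0 => l _; rewrite mul0mx mxE.
  move=> zL; exists (fun=> 0) => //; rewrite big_ord0.
  have zE i : (z *m delta_mx i (0 : 'I_1)) 0 0 = z 0 i.
    rewrite mxE (bigD1 i) //= mxE !eqxx mulr1 big1 ?addr0 // => j /negPf ji.
    by rewrite mxE ji mulr0.
  apply/rowP => i; rewrite mxE; apply/eqP; rewrite eq_le; apply/andP; split.
    have := zL (- delta_mx i 0); rewrite mulmxN mxE zE oppr_ge0; apply.
    rewrite mem_cat; apply/orP; right; apply/mapP.
    by exists i; rewrite ?mem_enum.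
  rewrite -zE; apply: zL; rewrite mem_cat; apply/orP; left; apply/mapP.
  by exists i; rewrite ?mem_enum.
have [L HL] := IHn (fun i => V (lift ord0 i)).
pose v := V ord0; pose h (l : 'cV[R]_d) := (v *m l) 0 0.
have step z : (exists2 w : 'I_n.+1 -> R, forall i, 0 <= w i
                 & z = \sum_i w i *: V i) <->
              (exists2 t, 0 <= t & forall l, l \in L -> t * h l <= (z *m l) 0 0).
  have zt t l : ((z - t *: v) *m l) 0 0 = (z *m l) 0 0 - t * h l.
    by rewrite mulmxBl -scalemxAl [LHS]mxE [X in _ + X]mxE [X in _ - X]mxE.
  split=> [[w w0 zE]|[t t0 Ht]].
    exists (w ord0) => // l lL; rewrite -subr_ge0 -zt.
    move: l lL; apply/HL.
    exists (fun i => w (lift ord0 i)) => //.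
    by rewrite zE big_ord_recl addrC addKr.
  have [|w w0 zE] := (HL (z - t *: v)).2.
    by move=> l lL; rewrite zt subr_ge0 Ht.
  exists (fun i => if unlift ord0 i is Some j then w j else t).
    by move=> i; case: unliftP.
  rewrite big_ord_recl unlift_none -(subrK (t *: v) z) addrC zE.
  by congr (_ + _); apply: eq_bigr => i _; rewrite liftK.
(* Lower bounds on [t] come from [h l < 0] and from [0 <= t], upper bounds from [0 < h l]. Each
   lower bound is compared with each upper bound; forms with [h l = 0] stay. *)
exists ([seq l <- L | 0 <= h l]
     ++ [seq h l2 *: l1 - h l1 *: l2 | l1 <- [seq l <- L | h l < 0],
                                       l2 <- [seq l <- L | 0 < h l]]) => z.
have comb l1 l2 : (z *m (h l2 *: l1 - h l1 *: l2)) 0 0 =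
    h l2 * (z *m l1) 0 0 - h l1 * (z *m l2) 0 0.
  rewrite mulmxBr -!scalemxAr [LHS]mxE [X in X + _]mxE [X in _ + X]mxE.
  by rewrite [X in _ - X]mxE.
apply: (iff_trans (step z)); split=> [[t t0 Ht] l|Hz].
  rewrite mem_cat => /orP[|/allpairsP[[l1 l2] /= []]].
    rewrite mem_filter => /andP[hl /Ht]; apply: le_trans.
    exact: mulr_ge0.
  rewrite !mem_filter => /andP[h1 /Ht H1] /andP[h2 /Ht H2] ->.
  rewrite comb subr_ge0.
  have A : h l1 * (z *m l2) 0 0 <= h l1 * (t * h l2) by rewrite ler_nM2l.
  have B : h l2 * (t * h l1) <= h l2 * (z *m l1) 0 0 by rewrite ler_pM2l.
  by lra.
have [t [t0 tmax tE]] := seq_max_attained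
  [seq l <- L | h l < 0] (fun l => (z *m l) 0 0 / h l).
exists t => // l lL.
have [hl|hl|hl] := ltgtP (h l) 0.
- have := tmax l; rewrite mem_filter hl lL => /(_ isT).
  by rewrite ler_ndivrMr.
- case: tE => [->|[l1]].
    by rewrite mul0r; apply: Hz; rewrite mem_cat mem_filter lL ltW.
  rewrite mem_filter => /andP[h1 l1L] ->.
  have : 0 <= (z *m (h l *: l1 - h l1 *: l)) 0 0.
    apply: Hz; rewrite mem_cat; apply/orP; right; apply/allpairsP.
    by exists (l1, l); rewrite !mem_filter /= h1 hl l1L lL.
  rewrite comb subr_ge0 mulrAC ler_ndivrMr // => H; lra.
- rewrite hl mulr0; apply: Hz; rewrite mem_cat mem_filter lL hl lexx //.
Qed.

(** * Affine forms and convex hulls of finite families *)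

(** A column encodes an affine form: two rows hold the gradient, the last one the constant term.
    This matches the lift of [x] to the row [(x, 1)]. *)
Definition lin (R : realType) (l : 'cV[R]_(2 + 1)) (x : 'rV[R]_2) : R :=
  (x *m usubmx l) 0 0.

Definition aff (R : realType) (l : 'cV[R]_(2 + 1)) (x : 'rV[R]_2) : R :=
  lin l x + dsubmx l 0 0.

Lemma linD (R : realType) (l : 'cV[R]_(2 + 1)) (x y : 'rV[R]_2) :
  lin l (x + y) = lin l x + lin l y.
Proof. by rewrite /lin mulmxDl mxE. Qed.

Lemma linZ (R : realType) (l : 'cV[R]_(2 + 1)) (a : R) (x : 'rV[R]_2) :
  lin l (a *: x) = a * lin l x.
Proof. by rewrite /lin -scalemxAl mxE. Qed.

Lemma linN (R : realType) (l : 'cV[R]_(2 + 1)) (x : 'rV[R]_2) :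
  lin l (- x) = - lin l x.
Proof. by rewrite /lin mulNmx mxE. Qed.

Lemma lin_sum (R : realType) (l : 'cV[R]_(2 + 1)) (I : finType)
    (x : I -> 'rV[R]_2) : lin l (\sum_i x i) = \sum_i lin l (x i).
Proof. by rewrite /lin mulmx_suml summxE. Qed.

Lemma aff_sum (R : realType) (l : 'cV[R]_(2 + 1)) (I : finType)
    (w : I -> R) (x : I -> 'rV[R]_2) :
  \sum_i w i * aff l (x i) =
    lin l (\sum_i (w i *: x i)) + (\sum_i w i) * dsubmx l 0 0.
Proof.
rewrite lin_sum mulr_suml -big_split /=; apply: eq_bigr => i _.
by rewrite linZ /aff mulrDr.
Qed.

Definition conv_points (R : realType) (n : nat) (V : 'I_n -> 'rV[R]_2) :
    set 'rV[R]_2 :=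
  [set x | exists w : 'I_n -> R,
     [/\ forall i, 0 <= w i, \sum_i w i = 1 & x = \sum_i w i *: V i]].

(** Homogenization: [x] lies in the hull exactly when [(x, 1)] lies in the cone of the lifted
    points, as the last coordinate forces the weights to sum to 1. *)
Lemma conv_points_polyhedral (R : realType) (n : nat) (V : 'I_n -> 'rV[R]_2) :
  exists L : seq 'cV[R]_(2 + 1), forall x,
    conv_points V x <-> (forall l, l \in L -> 0 <= aff l x).
Proof.
pose lft (x : 'rV[R]_2) : 'rV[R]_(2 + 1) := row_mx x (1%:M : 'M[R]_1).
have [L HL] := cone_polyhedral (fun i => lft (V i)).
have affE l x : (lft x *m l) 0 0 = aff l x.
  by rewrite -{1}(vsubmxK l) mul_row_col mul1mx mxE.
have sumE w : \sum_i w i *: lft (V i) =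
    row_mx (\sum_i w i *: V i) ((\sum_i w i)%:M : 'M[R]_1).
  under eq_bigr => i _ do rewrite scale_row_mx scalemx1.
  rewrite -(hsubmxK (\sum_i _)); congr row_mx.
    by rewrite linear_sum /=; apply: eq_bigr => i _; rewrite row_mxKl.
  by rewrite linear_sum raddf_sum /=; apply: eq_bigr => i _; rewrite row_mxKr.
exists L => x; split=> [[w [w0 w1 ->]] l lL|Hx].
  rewrite -affE; move: l lL; apply/HL; exists w => //.
  by rewrite sumE w1.
have [|w w0] := (HL (lft x)).2; first by move=> l lL; rewrite affE Hx.
rewrite sumE => /eq_row_mx[xE /matrixP/(_ 0 0)]; rewrite !mxE /= !mulr1n => w1.
by exists w.
Qed.

Definition cvx (R : realType) (S : set 'rV[R]_2) : Prop :=
  forall x y t, 0 <= t <= 1 -> S x -> S y -> S (t *: x + (1 - t) *: y).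

Lemma convex_setP (R : realType) (S : set 'rV[R]_2) : convex_set S <-> cvx S.
Proof.
split=> [Scvx x y t t01 Sx Sy|Scvx x y t /set_mem Sx /set_mem Sy].
  have := Scvx x y (Itv01 (andP t01).1 (andP t01).2) (mem_set Sx) (mem_set Sy).
  by move=> /set_mem.
by apply/mem_set/Scvx => //; rewrite ge0 le1.
Qed.

Lemma cvx_conv_points (R : realType) (n : nat) (V : 'I_n -> 'rV[R]_2) :
  cvx (conv_points V).
Proof.
move=> _ _ t /andP[t0 t1] [w [w0 w1 ->]] [u [u0 u1 ->]].
exists (fun i => t * w i + (1 - t) * u i); split.
- by move=> i; rewrite addr_ge0 ?mulr_ge0 ?subr_ge0.
- by rewrite big_split /= -!mulr_sumr w1 u1; ring.
- rewrite !scaler_sumr -big_split /=; apply: eq_bigr => i _.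
  by rewrite [RHS]scalerDl !scalerA.
Qed.

Lemma conv_points_vertex (R : realType) (n : nat) (V : 'I_n -> 'rV[R]_2) i :
  conv_points V (V i).
Proof.
exists (fun j => (j == i)%:R); split; first by move=> j; rewrite ler0n.
- by rewrite (bigD1 i) //= eqxx big1 ?addr0 // => j /negPf ->.
- rewrite (bigD1 i) //= eqxx scale1r big1 ?addr0 // => j /negPf ->.
  by rewrite scale0r.
Qed.

Lemma conv_points_min (R : realType) (n : nat) (V : 'I_n -> 'rV[R]_2)
    (S : set 'rV[R]_2) :
  cvx S -> (forall i, S (V i)) -> conv_points V `<=` S.
Proof.
(* Unnormalized weights let the induction drop the first point. *)
move=> Scvx; suff H m (W : 'I_m -> 'rV[R]_2) (w : 'I_m -> R) :
    (forall i, S (W i)) -> (forall i, 0 <= w i) -> 0 < \sum_i w i ->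
    S ((\sum_i w i)^-1 *: \sum_i w i *: W i).
  move=> SV x [w [w0 w1 ->]]; have := H _ V w SV w0.
  by rewrite w1 invr1 scale1r; exact.
elim: m W w => [|m IHm] W w SW w0; first by rewrite big_ord0 ltxx.
rewrite !big_ord_recl /=; set s := \sum_i _; set y := \sum_i _ => pos.
have s0 : 0 <= s by apply: sumr_ge0.
have [s1|] := eqVneq s 0.
  have -> : y = 0.
    apply: big1 => i _; move/psumr_eq0P: s1 => ->; rewrite ?scale0r //.
  move: pos; rewrite s1 !addr0 => w00.
  by rewrite scalerA mulVf ?gt_eqF // scale1r.
move=> sn0; have sp : 0 < s by rewrite lt_neqAle eq_sym sn0.
have := IHm (W \o lift ord0) (w \o lift ord0) (fun i => SW _) (fun i => w0 _) sp.
rewrite /= -/s -/y => Sy.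
have -> : (w ord0 + s)^-1 *: (w ord0 *: W ord0 + y) =
    (w ord0 / (w ord0 + s)) *: W ord0 +
    (1 - w ord0 / (w ord0 + s)) *: (s^-1 *: y).
  rewrite scalerDr !scalerA; congr (_ *: _ + _ *: _); first by rewrite mulrC.
  by field; rewrite sn0 gt_eqF.
apply: Scvx => //; apply/andP; split; first by rewrite divr_ge0 // ltW.
by rewrite ler_pdivrMr // mul1r lerDl.
Qed.

Lemma convex_hull_conv_points (R : realType) (F : {fset 'rV[R]_2}) :
  convex_hull [set` F] =
  conv_points (fun i : 'I_(size (enum_fset F)) => nth 0 (enum_fset F) i).
Proof.
apply/seteqP; split.
  apply: smallest_sub.
    by apply/convex_setP; exact: cvx_conv_points.
  move=> x /= xF; have ix : (index x (enum_fset F) < size (enum_fset F))%N.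
    by rewrite index_mem.
  have -> : x = nth 0 (enum_fset F) (Ordinal ix) by rewrite /= nth_index.
  exact: conv_points_vertex.
apply: conv_points_min.
  move=> x y t t01 Hx Hy B BF; have [/convex_setP Bcvx _] := BF.
  by apply: Bcvx => //; [exact: Hx|exact: Hy].
move=> i B [_]; apply; rewrite /= -[_ \in F]/(_ \in enum_fset F).
exact: mem_nth.
Qed.

(** * Irredundant presentations of a polygon *)

(* [pres_vertex] and [pres_facet] express that neither the list of vertices nor
   the list of inequalities is redundant. *)
Record presentation (R : realType) (C : set 'rV[R]_2) (n : nat)
    (V : 'I_n -> 'rV[R]_2) (k : nat) (E : 'I_k -> 'cV[R]_(2 + 1))
    (o : 'rV[R]_2) : Prop := Presentation {
  pres_conv : C = conv_points V;
  pres_vertex : forall i a b t, a != i -> b != i -> 0 <= t <= 1 ->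
    V i <> t *: V a + (1 - t) *: V b;
  pres_aff : forall x, C x <-> forall e, 0 <= aff (E e) x;
  pres_facet : forall e, exists x,
    aff (E e) x < 0 /\ forall f, f != e -> 0 <= aff (E f) x;
  pres_center : forall e, 0 < aff (E e) o
}.

(** Take the fewest points: one on a segment between others could be dropped. Allowing [a = b] also
    excludes repeated points. *)
Lemma conv_points_minimal (R : realType) (C : set 'rV[R]_2) (m : nat)
    (W : 'I_m -> 'rV[R]_2) : C = conv_points W ->
  exists n (V : 'I_n -> 'rV[R]_2), C = conv_points V /\
    forall i a b t, a != i -> b != i -> 0 <= t <= 1 ->
      V i <> t *: V a + (1 - t) *: V b.
Proof.
move=> CW; pose P n := `[< exists V : 'I_n -> 'rV[R]_2, C = conv_points V >].
have exP : exists n, P n by exists m; apply/asboolP; exists W.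
have [n /asboolP[V CV] nmin] := ex_minnP exP.
exists n, V; split => // i a b t ai bi t01 Vi.
case: n => [|n] in V CV nmin i a b ai bi Vi *; first by case: i ai bi Vi.
suff /nmin : P n by rewrite ltnn.
apply/asboolP; exists (fun j => V (lift i j)); rewrite CV; apply/seteqP; split.
  have VP j : j != i -> conv_points (fun j => V (lift i j)) (V j).
    rewrite eq_sym => /unlift_some[j' -> _].
    exact: (conv_points_vertex (fun j => V (lift i j))).
  apply: conv_points_min; first exact: cvx_conv_points.
  move=> j; have [->|/VP //] := eqVneq j i.
  by rewrite Vi; apply: cvx_conv_points => //; exact: VP.
apply: conv_points_min; first exact: cvx_conv_points.
by move=> j; exact: conv_points_vertex.
Qed.

(** Take the fewest inequalities: one that no point violates alone would follow from the others. *)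
Lemma polyhedral_minimal (R : realType) (C : set 'rV[R]_2)
    (L : seq 'cV[R]_(2 + 1)) :
  (forall x, C x <-> forall l, l \in L -> 0 <= aff l x) ->
  exists k (E : 'I_k -> 'cV[R]_(2 + 1)),
    (forall x, C x <-> forall e, 0 <= aff (E e) x) /\
    (forall e, exists x,
      aff (E e) x < 0 /\ forall f, f != e -> 0 <= aff (E f) x).
Proof.
move=> CL; pose P k := `[< exists E : 'I_k -> 'cV[R]_(2 + 1),
  forall x, C x <-> forall e, 0 <= aff (E e) x >].
have exP : exists k, P k.
  exists (size L); apply/asboolP; exists (fun i => nth 0 L i) => x.
  apply: (iff_trans (CL x)); split => [H e|H l lL].
    by apply: H; rewrite mem_nth.
  have il : (index l L < size L)%N by rewrite index_mem.
  by have := H (Ordinal il); rewrite /= nth_index.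
have [k /asboolP[E CE] kmin] := ex_minnP exP.
exists k, E; split => // e; apply: contrapT => noX.
case: k => [|k] in E CE kmin e noX *; first by case: e noX.
suff /kmin : P k by rewrite ltnn.
apply/asboolP; exists (fun j => E (lift e j)) => x.
apply: (iff_trans (CE x)); split => [H f|H f]; first exact: H.
have HE g : g != e -> 0 <= aff (E g) x.
  by rewrite eq_sym => /unlift_some[g' -> _]; exact: H.
have [->|/HE //] := eqVneq f e.
by rewrite leNgt; apply/negP => ex0; apply: noX; exists x.
Qed.

Lemma interior_segment (R : realType) (C : set 'rV[R]_2) (o x : 'rV[R]_2) :
  C° o -> exists2 d : R, 0 < d & C (o + d *: (x - o)).
Proof.
move=> /nbhs_ballP[e /= e0 oC].
have pos : 0 < `|x - o| + 1 by rewrite ltr_wpDl.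
pose q := e / (`|x - o| + 1); have q0 : 0 < q by rewrite divr_gt0.
exists (q / 2); first by rewrite divr_gt0.
apply: oC; rewrite -ball_normE /= opprD addrA subrr add0r normrN normrZ.
rewrite gtr0_norm ?divr_gt0 //.
have -> : e = q * (`|x - o| + 1) by rewrite divfK // gt_eqF.
have : 0 <= `|x - o| by [].
by nra.
Qed.

Lemma convex_polygon_presentation (R : realType) (C : set 'rV[R]_2) :
  convex_polygon C ->
  exists n (V : 'I_n -> 'rV[R]_2) k (E : 'I_k -> 'cV[R]_(2 + 1)) o,
    presentation C V E o.
Proof.
move=> [[F]]; rewrite convex_hull_conv_points => CF [x0 oC].
have [n [V [CV Vmin]]] := conv_points_minimal CF.
have [L] := conv_points_polyhedral V; rewrite -CV => /polyhedral_minimal.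
move=> [k [E [CE Emin]]]; exists n, V, k, E, x0; split => // e.
(* If [E e] vanished at the interior point [x0], a small step towards a violating point [x] would
   leave [C]. *)
have [x [ex0 _]] := Emin e.
have [d d0 /CE /(_ e) H2] := interior_segment x oC.
have /CE /(_ e) H1 := interior_subset oC.
rewrite lt_neqAle H1 andbT; apply/eqP => H0.
have : d * aff (E e) x < 0 by rewrite pmulr_rlt0.
have : d * aff (E e) x0 = 0 by rewrite -H0 mulr0.
by move: H0 H2; rewrite /aff !(linD, linZ, linN); lra.
Qed.

(** * Homothetic copies in terms of edge inequalities *)

(** A homothety scales each edge form by [l] and adds a constant, so the copy is cut out by the same
    forms with new thresholds. *)
Lemma mem_copy (R : realType) (C : set 'rV[R]_2) n (V : 'I_n -> 'rV[R]_2)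
    k (E : 'I_k -> 'cV[R]_(2 + 1)) o (l : R) (v p : 'rV[R]_2) :
  presentation C V E o -> 0 < l ->
  [set l *: x + v | x in C] p <->
  forall e, aff (E e) v - l * dsubmx (E e) 0 0 <= aff (E e) p.
Proof.
move=> pres l0; have ln0 : l != 0 by rewrite gt_eqF.
have key e x : aff (E e) (l *: x + v) - (aff (E e) v - l * dsubmx (E e) 0 0) =
    l * aff (E e) x.
  by rewrite /aff linD linZ; ring.
split=> [[x /(pres_aff pres) Cx <-] e|H].
  by rewrite -subr_ge0 key mulr_ge0 // ltW.
exists (l^-1 *: (p - v)); last by rewrite scalerA mulfV // scale1r subrK.
apply/(pres_aff pres) => e; rewrite -(pmulr_rge0 _ l0) -key.
by rewrite scalerA mulfV // scale1r subrK subr_ge0.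
Qed.

Lemma copy_sub (R : realType) (C : set 'rV[R]_2) n (V : 'I_n -> 'rV[R]_2)
    k (E : 'I_k -> 'cV[R]_(2 + 1)) o (l : R) (v : 'rV[R]_2) :
  presentation C V E o -> 0 < l ->
  (forall e, 0 <= aff (E e) v - l * dsubmx (E e) 0 0) ->
  [set l *: x + v | x in C] `<=` C.
Proof.
move=> pres l0 H x /(mem_copy _ _ pres l0) Hx.
by apply/(pres_aff pres) => e; exact: le_trans (H e) (Hx e).
Qed.

(* The copies with center [g] inside the copy [q + s C], decreasing in [t]. *)
Definition nested_copy (R : realType) (C : set 'rV[R]_2) (q g : 'rV[R]_2)
    (s t : R) : set 'rV[R]_2 :=
  [set (s * (1 - t)) *: x + (q + (s * t) *: g) | x in C].

Lemma mem_nested_copy (R : realType) (C : set 'rV[R]_2) n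
    (V : 'I_n -> 'rV[R]_2) k (E : 'I_k -> 'cV[R]_(2 + 1)) o
    (q g p : 'rV[R]_2) (s t : R) :
  presentation C V E o -> 0 < s -> t < 1 ->
  nested_copy C q g s t p <-> forall e,
    aff (E e) q - s * dsubmx (E e) 0 0 + s * t * aff (E e) g <= aff (E e) p.
Proof.
move=> pres s0; rewrite -subr_gt0 => t1.
apply: (iff_trans (mem_copy _ _ pres (mulr_gt0 s0 t1))).
by split=> H e; apply: le_trans (H e); rewrite /aff linD linZ;
  rewrite le_eqVlt; apply/orP; left; apply/eqP; ring.
Qed.

(** The copies are nested, so the smallest of finitely many parameters gives one copy that contains
    all of [P] and still misses [r]. *)
Lemma nested_copies_cover (R : realType) (C : set 'rV[R]_2) n
    (V : 'I_n -> 'rV[R]_2) k (E : 'I_k -> 'cV[R]_(2 + 1)) o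
    (q g r : 'rV[R]_2) (s : R) (P : seq 'rV[R]_2) :
  presentation C V E o -> 0 < s ->
  (forall e, 0 <= aff (E e) q - s * dsubmx (E e) 0 0) -> C g ->
  (forall p, p \in P -> exists t,
    [/\ 0 <= t, t < 1, nested_copy C q g s t p & ~ nested_copy C q g s t r]) ->
  exists F : set 'rV[R]_2,
    [/\ F `<=` C, F = set0 \/ homothetic_copy C F, ~ F r
      & forall p, p \in P -> F p].
Proof.
move=> pres s0 Hq /(pres_aff pres) Cg HP; pose D := nested_copy C q g s.
have DP t p : t < 1 -> D t p <-> forall e,
    aff (E e) q - s * dsubmx (E e) 0 0 + s * t * aff (E e) g <= aff (E e) p.
  exact: (mem_nested_copy _ _ _ pres s0).
suff [->|[t [t0 t1 Dr HD]]] : P = [::] \/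
    exists t, [/\ 0 <= t, t < 1, ~ D t r & forall p, p \in P -> D t p].
- by exists set0; split => //; left.
- exists (D t); split => //.
    move=> x /(DP _ _ t1) Dx; apply/(pres_aff pres) => e.
    by apply: le_trans (Dx e); rewrite addr_ge0 // mulr_ge0 // mulr_ge0 // ltW.
  right; exists (s * (1 - t)), (q + (s * t) *: g); split => //.
  by rewrite mulr_gt0 // subr_gt0.
elim: P HP => [|p P IHP] HP; [by left|right].
have [t [t0 t1 Dp Dr]] := HP _ (mem_head _ _).
case: IHP => [p' p'P|->|[u [u0 u1 Du HD]]].
- by apply: HP; rewrite in_cons p'P orbT.
- by exists t; split => // p'; rewrite mem_seq1 => /eqP ->.
have mono x a b : a <= b -> a < 1 -> b < 1 -> D b x -> D a x.
  move=> ab a1 b1 /(DP _ _ b1) H; apply/(DP _ _ a1) => e.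
  by apply: le_trans (H e); rewrite lerD2l ler_wpM2r // ler_wpM2l // ltW.
have [tu|ut] := leP t u.
  exists t; split => // p'; rewrite in_cons => /predU1P[->//|/HD].
  exact: mono.
exists u; split => // p'; rewrite in_cons => /predU1P[->|/HD //].
by apply: mono Dp => //; exact: ltW.
Qed.

(** * Bounds on vertex weights *)

(** A predicate on functions, so that constants and combinations of [aff] and [along] can serve as
    test forms. *)
Definition is_affine (R : realType) (u : 'rV[R]_2 -> R) : Prop :=
  forall x y t, u (t *: x + (1 - t) *: y) = t * u x + (1 - t) * u y.

Lemma is_affine_aff (R : realType) (l : 'cV[R]_(2 + 1)) : is_affine (aff l).
Proof. by move=> x y t; rewrite /aff linD !linZ; ring. Qed.

Lemma is_affine_ge0 (R : realType) n (V : 'I_n -> 'rV[R]_2)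
    (u : 'rV[R]_2 -> R) :
  is_affine u -> (forall i, 0 <= u (V i)) ->
  forall x, conv_points V x -> 0 <= u x.
Proof.
move=> uaff uV; apply: (@conv_points_min _ _ _ [set x | 0 <= u x]) => //.
move=> x y t /andP[t0 t1] /= ux uy; rewrite uaff.
by rewrite addr_ge0 // mulr_ge0 // subr_ge0.
Qed.

(* [b] is a weight that [g] can carry in a convex representation of a point
   that is not separated from [r] by a copy with center [g]. *)
Definition weight_below (R : realType) (C : set 'rV[R]_2) (g r : 'rV[R]_2)
    (b : R) : Prop :=
  forall u, is_affine u -> (forall x, C x -> 0 <= u x) -> b * u g <= u r.

(** The gradient of [lin l] turned by a right angle: a coordinate along the level lines of
    [aff l]. *)
Definition along (R : realType) (l : 'cV[R]_(2 + 1)) (x : 'rV[R]_2) : R :=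
  x 0 1 * usubmx l 0 0 - x 0 0 * usubmx l 1 0.

Lemma along_affine (R : realType) (l : 'cV[R]_(2 + 1)) : is_affine (along l).
Proof. by move=> x y t; rewrite /along !mxE; ring. Qed.

Lemma lin_along_inj (R : realType) (l : 'cV[R]_(2 + 1)) (x y : 'rV[R]_2) :
  usubmx l != 0 -> aff l x = aff l y -> along l x = along l y -> x = y.
Proof.
have linE z : lin l z = z 0 0 * usubmx l 0 0 + z 0 1 * usubmx l 1 0.
  rewrite /lin mxE big_ord_recl big_ord1 /=.
  by have -> : lift ord0 ord0 = 1 :> 'I_2 by exact/val_inj.
set a := usubmx l 0 0; set b := usubmx l 1 0 => ln0.
have ab : 0 < a ^+ 2 + b ^+ 2.
  rewrite lt_neqAle addr_ge0 ?sqr_ge0 // andbT eq_sym.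
  rewrite paddr_eq0 ?sqr_ge0 // !sqrf_eq0; apply: contra ln0.
  move=> /andP[/eqP a0 /eqP b0]; apply/eqP/matrixP => i j.
  rewrite (ord1 j) [RHS]mxE; case: i => [[|[|//]] Hi].
    by rewrite -[RHS]a0; congr (usubmx l _ _); exact/val_inj.
  by rewrite -[RHS]b0; congr (usubmx l _ _); exact/val_inj.
rewrite /aff !linE /along -/a -/b => H1 H2.
have H : (a ^+ 2 + b ^+ 2) * (x 0 0 - y 0 0) = 0 /\
         (a ^+ 2 + b ^+ 2) * (x 0 1 - y 0 1) = 0.
  have H3 : (x 0 0 - y 0 0) * a + (x 0 1 - y 0 1) * b = 0 by lra.
  have H4 : (x 0 1 - y 0 1) * a - (x 0 0 - y 0 0) * b = 0 by lra.
  split; apply/eqP; [rewrite -[eqbRHS](_ :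
    a * ((x 0 0 - y 0 0) * a + (x 0 1 - y 0 1) * b) -
    b * ((x 0 1 - y 0 1) * a - (x 0 0 - y 0 0) * b) = 0)|
    rewrite -[eqbRHS](_ :
    b * ((x 0 0 - y 0 0) * a + (x 0 1 - y 0 1) * b) +
    a * ((x 0 1 - y 0 1) * a - (x 0 0 - y 0 0) * b) = 0)];
    by [apply/eqP; ring|rewrite H3 H4; ring].
case: H => /eqP + /eqP; rewrite !mulf_eq0 gt_eqF //= !subr_eq0.
move=> /eqP x0 /eqP x1; apply/rowP => j; case: j => [[|[|//]] Hj].
  by rewrite (_ : Ordinal _ = 0) //; exact/val_inj.
by rewrite (_ : Ordinal _ = 1) //; exact/val_inj.
Qed.

(* An edge line [aff (E e) = 0] contains at most two vertices [V a] and [V b];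
   the forms [K * aff (E e) + (along - along (V a))] and
   [K * aff (E e) + (along (V b) - along)] vanish at one of them and add up to
   a constant along the edge. *)
Lemma edge_weight_below (R : realType) (C : set 'rV[R]_2) n
    (V : 'I_n -> 'rV[R]_2) k (E : 'I_k -> 'cV[R]_(2 + 1)) o (e : 'I_k) :
  presentation C V E o ->
  exists2 K : R, 0 <= K & forall r, C r -> exists m : 'I_n -> R,
    [/\ forall i, 0 <= m i, \sum_i m i <= 1 + K * aff (E e) r
      & forall i b, aff (E e) (V i) = 0 -> weight_below C (V i) r b -> b <= m i].
Proof.
move=> pres; set l := E e.
have CV i : C (V i) by rewrite (pres_conv pres); exact: conv_points_vertex.
have lV i : 0 <= aff l (V i) by apply: (pres_aff pres _).1.
have le1 i r b : weight_below C (V i) r b -> b <= 1.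
  move=> /(_ (fun=> 1)); rewrite mulr1; apply => // x y t.
  by ring.
have [/existsP[i0 i0T]|] := boolP [exists i, aff l (V i) == 0]; last first.
  rewrite negb_exists => /forallP noT.
  exists 0 => // r _; exists (fun=> 0); split => //.
    by rewrite big1 ?mul0r ?addr0 ?ler01.
  by move=> i b /eqP /(elimN idP (noT i)).
(* A constant form that vanishes at a vertex would vanish at the center. *)
have ln0 : usubmx l != 0.
  apply/eqP => l0; move: (pres_center pres e) (eqP i0T).
  by rewrite -/l /aff /lin l0 !mulmx0 !mxE => /[swap] ->; rewrite ltxx.
pose T := [pred i | aff l (V i) == 0].
pose t i := along l (V i).
have [a aT amin] := @arg_minP _ _ _ i0 T t i0T.
have [b bT bmax] := @arg_maxP _ _ _ i0 T t i0T.
have {}bmax i : T i -> t i <= t b by exact: bmax.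
have inj i j : T i -> T j -> t i = t j -> V i = V j.
  by move=> /eqP iT /eqP jT; apply: lin_along_inj ln0 _; rewrite iT jT.
have Vneq i j : i != j -> V i <> V j.
  move=> ij; have := @pres_vertex _ _ _ _ _ _ _ pres i j j 1.
  rewrite subrr scale1r scale0r addr0 eq_sym ij ler01 lexx.
  by move=> /(_ isT isT isT).
(* A third vertex on the edge line would lie between [V a] and [V b]. *)
have Tab i : T i -> i = a \/ i = b.
  move=> iT; have [->|ia] := eqVneq i a; first by left.
  have [->|ib] := eqVneq i b; first by right.
  have [tba|tab] := leP (t b) (t a).
    case: (Vneq i a ia); apply: inj => //; apply/eqP; rewrite eq_le amin // andbT.
    by apply: le_trans tba; exact: bmax.
  have d0 : t b - t a != 0 by rewrite gt_eqF // subr_gt0.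
  pose s := (t b - t i) / (t b - t a).
  case: (@pres_vertex _ _ _ _ _ _ _ pres i a b s); rewrite 1?eq_sym //.
    rewrite divr_ge0 ?subr_ge0 ?ler_pdivrMr ?mul1r ?subr_gt0 //=.
    - by rewrite lerB // amin.
    - exact: bmax.
    - exact: ltW.
  apply: (lin_along_inj ln0); rewrite (is_affine_aff, along_affine).
    by rewrite (eqP aT) (eqP bT) (eqP iT); ring.
  by rewrite -/(t i) -/(t a) -/(t b) /s; field.
have [ab|ab] := eqVneq a b.
  exists 0 => // r _; exists (fun i => (i == a)%:R); split.
  - by move=> i; rewrite ler0n.
  - rewrite (bigD1 a) //= eqxx big1 ?mul0r // => i /negPf ->//.
  - move=> i c /eqP /Tab; rewrite -ab => -[] -> /le1; by rewrite eqxx.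
have d0 : 0 < t b - t a.
  rewrite subr_gt0 lt_neqAle amin // andbT; apply/eqP => tab.
  by case: (Vneq a b ab); exact: inj.
(* Large enough for [ua] and [ub] below to be nonnegative at the vertices off the edge line; on it
   the division by 0 contributes 0. *)
pose K := \sum_i (`|t b - t i| + `|t i - t a|) / aff l (V i).
have Kterm i : 0 <= (`|t b - t i| + `|t i - t a|) / aff l (V i).
  by rewrite divr_ge0 // addr_ge0.
have K0 : 0 <= K by exact: sumr_ge0.
have Ki i : `|t b - t i| + `|t i - t a| <= K * aff l (V i) \/ T i.
  have [iT|iT] := boolP (T i); [by right|left].
  rewrite -ler_pdivrMr; last by rewrite lt_neqAle eq_sym iT lV.
  by rewrite /K (bigD1 i) //= lerDl sumr_ge0.
pose ua x := K * aff l x + (t b - along l x).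
pose ub x := K * aff l x + (along l x - t a).
have uaA : is_affine ua.
  by move=> x y s; rewrite /ua is_affine_aff along_affine; ring.
have ubA : is_affine ub.
  by move=> x y s; rewrite /ub is_affine_aff along_affine; ring.
have ua0 x : C x -> 0 <= ua x.
  rewrite (pres_conv pres); apply: is_affine_ge0 => // i; rewrite /ua -/(t i).
  case: (Ki i) => [H|iT]; last by rewrite (eqP iT) mulr0 add0r subr_ge0 bmax.
  by have := ler_norm (t i - t b); rewrite distrC; have := normr_ge0 (t i - t a); lra.
have ub0 x : C x -> 0 <= ub x.
  rewrite (pres_conv pres); apply: is_affine_ge0 => // i; rewrite /ub -/(t i).
  case: (Ki i) => [H|iT]; last by rewrite (eqP iT) mulr0 add0r subr_ge0 amin.
  by have := ler_norm (t a - t i); rewrite distrC; have := normr_ge0 (t b - t i); lra.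
have dn0 := lt0r_neq0 d0.
exists (2 * K / (t b - t a)); first by rewrite divr_ge0 ?mulr_ge0 // ltW.
(* Here [ua + ub] is [2 * K * aff l + (t b - t a)], and both [ua (V a)] and [ub (V b)] are
   [t b - t a]. *)
move=> r Cr; exists (fun i => (i == a)%:R * (ua r / (t b - t a)) +
                              (i == b)%:R * (ub r / (t b - t a))); split.
- move=> i; rewrite addr_ge0 // mulr_ge0 ?ler0n // divr_ge0 ?ua0 ?ub0 //;
    exact: ltW.
- rewrite big_split /= -!mulr_suml.
  have one c : \sum_(i < n) (i == c)%:R = 1 :> R.
    by rewrite (bigD1 c) //= eqxx big1 ?addr0 // => i /negPf ->.
  rewrite !one !mul1r /ua /ub le_eqVlt; apply/orP; left; apply/eqP.
  by field.
- move=> i c /eqP /Tab[] -> Hc.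
    rewrite eqxx (negPf ab) mul1r mul0r addr0 ler_pdivlMr //.
    by have := Hc _ uaA ua0; rewrite {1}/ua (eqP aT) mulr0 add0r.
  rewrite eqxx (eq_sym b) (negPf ab) mul1r mul0r add0r ler_pdivlMr //.
  by have := Hc _ ubA ub0; rewrite {1}/ub (eqP bT) mulr0 add0r.
Qed.

(* [s] is a depth of [r] in [C]: the copy [r + s (C - o)] lies in [C].  At
   bounded depth the total weight available at the vertices exceeds 1 by a
   multiple of the depth only. *)
Lemma weight_below_depth (R : realType) (C : set 'rV[R]_2) n
    (V : 'I_n -> 'rV[R]_2) k (E : 'I_k -> 'cV[R]_(2 + 1)) o :
  presentation C V E o ->
  exists2 K : R, 0 <= K & forall r, C r -> exists s (m : 'I_n -> R),
    [/\ 0 <= s, forall e, s * aff (E e) o <= aff (E e) r,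
        \sum_i m i <= 1 + K * s
      & forall i b, weight_below C (V i) r b -> b <= m i].
Proof.
move=> pres.
have CV i : C (V i) by rewrite (pres_conv pres); exact: conv_points_vertex.
have lV e i : 0 <= aff (E e) (V i) by apply: (pres_aff pres _).1.
have /choice[K HK] : forall e, exists K, 0 <= K /\
    forall r, C r -> exists m : 'I_n -> R,
    [/\ forall i, 0 <= m i, \sum_i m i <= 1 + K * aff (E e) r
      & forall i b, weight_below C (V i) r b -> b <= m i].
  move=> e; have [K K0 HK] := edge_weight_below e pres.
  (* Off the edge line, [aff (E e)] itself is a test form that bounds the weight; on it the inverse
     of 0 adds nothing. *)
  exists (K + \sum_i (aff (E e) (V i))^-1); split.
    by rewrite addr_ge0 // sumr_ge0 // => i _; rewrite invr_ge0.
  move=> r Cr; have [m [m0 msum mP]] := HK r Cr.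
  have r0 : 0 <= aff (E e) r by apply: (pres_aff pres _).1.
  exists (fun i => m i + (aff (E e) (V i))^-1 * aff (E e) r); split.
  - by move=> i; rewrite addr_ge0 // mulr_ge0 // invr_ge0.
  - by rewrite big_split /= -mulr_suml mulrDl addrA lerD2r.
  - move=> i b Hb; have [iT|iT] := eqVneq (aff (E e) (V i)) 0.
      by rewrite iT invr0 mul0r addr0; exact: mP.
    apply: (@le_trans _ _ ((aff (E e) (V i))^-1 * aff (E e) r)); last by rewrite lerDr.
    rewrite mulrC ler_pdivlMr; last by rewrite lt_neqAle eq_sym iT lV.
    by apply: Hb; [exact: is_affine_aff|move=> x /(pres_aff pres)].
exists (2 * n%:R + \sum_e K e * aff (E e) o).
  rewrite addr_ge0 ?mulr_ge0 ?ler0n // sumr_ge0 // => e _.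
  by rewrite mulr_ge0 //; [case: (HK e)|exact: ltW (pres_center pres e)].
move=> r Cr.
have r0 e : 0 <= aff (E e) r by apply: (pres_aff pres _).1.
(* The depth will be [2^-1 - s], the minimum of 1/2 and the ratios [aff (E e) r / aff (E e) o]. *)
have [s [s0 smax sE]] := seq_max_attained (enum 'I_k)
  (fun e => 2^-1 - aff (E e) r / aff (E e) o).
have {}smax e : (2^-1 - s) * aff (E e) o <= aff (E e) r.
  have := smax e; rewrite mem_enum => /(_ isT) H.
  by rewrite -ler_pdivlMr ?(pres_center pres) //; lra.
have sum0 : 0 <= \sum_e K e * aff (E e) o.
  rewrite sumr_ge0 // => e _.
  by rewrite mulr_ge0 //; [case: (HK e)|exact: ltW (pres_center pres e)].
case: sE => [sE|[e _ sE]].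
  (* At the cap 1/2 every weight is at most 1, and the term [2 * n%:R] absorbs their sum. *)
  exists (2^-1), (fun=> 1); split => //.
  - by move: smax; rewrite sE subr0.
  - rewrite sumr_const card_ord -[1 *+ n]/(n%:R); nra.
  - move=> i b /(_ (fun=> 1)); rewrite mulr1; apply => // x y t; ring.
have [K0 /(_ r Cr) [m [m0 msum mP]]] := HK e.
exists (2^-1 - s), m; split => //.
- by rewrite sE opprB addrC subrK divr_ge0 // ltW // (pres_center pres).
- apply: le_trans msum _; rewrite lerD2l.
  have -> : aff (E e) r = (2^-1 - s) * aff (E e) o.
    by rewrite sE opprB addrC subrK divfK // gt_eqF // (pres_center pres).
  have s1 : 0 <= 2^-1 - s.
    by rewrite sE opprB addrC subrK divr_ge0 // ltW // (pres_center pres).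
  rewrite mulrCA mulrC ler_wpM2r //.
  rewrite (bigD1 e) //= addrCA lerDl addr_ge0 ?mulr_ge0 ?ler0n // sumr_ge0 // => f _.
  by rewrite mulr_ge0 //; [case: (HK f)|exact: ltW (pres_center pres f)].
Qed.

(** * Copies separating the center from nearby points *)

Lemma finite_pos_lower_bound (R : realType) (I : finType) (a : I -> R) :
  (forall i, 0 < a i) -> exists2 d, 0 < d & forall i, d <= a i.
Proof.
move=> a0; have S0 : 0 <= \sum_i (a i)^-1.
  by apply: sumr_ge0 => i _; rewrite invr_ge0 ltW.
exists (1 + \sum_i (a i)^-1)^-1; first by rewrite invr_gt0 ltr_wpDr.
move=> i; rewrite -[leRHS]invrK lef_pV2 ?posrE ?invr_gt0 ?ltr_wpDr //.
rewrite (bigD1 i) //= addrCA lerDl addr_ge0 // sumr_ge0 // => j _.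
by rewrite invr_ge0 ltW.
Qed.

Lemma presentation_aff_bounded (R : realType) (C : set 'rV[R]_2) n
    (V : 'I_n -> 'rV[R]_2) k (E : 'I_k -> 'cV[R]_(2 + 1)) o :
  presentation C V E o ->
  exists2 B, 0 < B & forall x e, C x -> aff (E e) x <= B.
Proof.
move=> pres; pose B := 1 + \sum_i \sum_e `|aff (E e) (V i)|.
have S0 : 0 <= \sum_i \sum_e `|aff (E e) (V i)| by do 2![apply: sumr_ge0 => ? _].
exists B => [|x e]; first by rewrite ltr_wpDr.
rewrite (pres_conv pres) -subr_ge0 => Cx.
apply: (@is_affine_ge0 _ _ V (fun x => B - aff (E e) x)) Cx.
  by move=> y z t; rewrite is_affine_aff; ring.
move=> i; rewrite subr_ge0 (le_trans (ler_norm _)) // /B.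
rewrite (bigD1 i) //= (bigD1 e) //= [leRHS]addrC -!addrA lerDl.
by rewrite !addr_ge0 // !sumr_ge0 // => j _; exact: sumr_ge0.
Qed.

Lemma presentation_bounded (R : realType) (C : set 'rV[R]_2) n
    (V : 'I_n -> 'rV[R]_2) k (E : 'I_k -> 'cV[R]_(2 + 1)) o :
  presentation C V E o -> exists B, forall x j, C x -> `|x 0 j| <= B.
Proof.
move=> pres; pose B := \sum_i \sum_j `|V i 0 j|.
exists B => x j; rewrite (pres_conv pres).
apply: (@conv_points_min _ _ _ [set x | `|x 0 j| <= B]).
  move=> y z t /andP[t0 t1] /= yB zB; rewrite !mxE.
  apply: le_trans (ler_normD _ _) _; rewrite !normrM.
  rewrite (ger0_norm t0) (@ger0_norm _ (1 - t)) ?subr_ge0 //.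
  have H1 : t * `|y 0 j| <= t * B by rewrite ler_wpM2l.
  have H2 : (1 - t) * `|z 0 j| <= (1 - t) * B by rewrite ler_wpM2l ?subr_ge0.
  by lra.
move=> i /=; rewrite /B (bigD1 i) //= (bigD1 j) //= -addrA lerDl.
by rewrite addr_ge0 // !sumr_ge0 // => l _; exact: sumr_ge0.
Qed.

(* Otherwise [C] would contain the ray from [x] in the direction [x - p]. *)
Lemma aff_le_eq (R : realType) (C : set 'rV[R]_2) n
    (V : 'I_n -> 'rV[R]_2) k (E : 'I_k -> 'cV[R]_(2 + 1)) o (x p : 'rV[R]_2) :
  presentation C V E o -> C x ->
  (forall e, aff (E e) p <= aff (E e) x) -> p = x.
Proof.
move=> pres Cx px; have [B HB] := presentation_bounded pres.
apply/rowP => j; apply/eqP; rewrite eq_sym -subr_eq0; apply: contrapT => /negP ne.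
have ne0 : 0 < `|x 0 j - p 0 j| by rewrite normr_gt0.
pose t := (2 * B + 1) / `|x 0 j - p 0 j|.
have B0 : 0 <= B by apply: le_trans (HB _ j Cx).
have t0 : 0 <= t by rewrite divr_ge0 // addr_ge0 ?mulr_ge0.
have /(HB _ j) : C (x + t *: (x - p)).
  apply/(pres_aff pres) => e.
  have x0 : 0 <= aff (E e) x by apply: (pres_aff pres _).1.
  have -> : aff (E e) (x + t *: (x - p)) =
      aff (E e) x + t * (aff (E e) x - aff (E e) p).
    by rewrite /aff linD linZ linD linN; ring.
  by rewrite addr_ge0 // mulr_ge0 // subr_ge0.
rewrite !mxE => H.
have H1 : `|t * (x 0 j - p 0 j)| <= B + B.
  have -> : t * (x 0 j - p 0 j) = (x 0 j + t * (x 0 j - p 0 j)) - x 0 j by ring.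
  by apply: le_trans (ler_normB _ _) _; rewrite lerD // HB.
move: H1; rewrite normrM (ger0_norm t0) /t divfK ?gt_eqF //.
by lra.
Qed.

(* [g] is the center moved away from a point that violates only the
   inequality [e], so that a copy with center [g] passing next to [o] has an
   edge parallel to [e] there. *)
Lemma edge_center_cover (R : realType) (C : set 'rV[R]_2) n
    (V : 'I_n -> 'rV[R]_2) k (E : 'I_k -> 'cV[R]_(2 + 1)) o (e : 'I_k) :
  presentation C V E o ->
  exists gd : 'rV[R]_2 * R, [/\ C gd.1, 0 < gd.2 &
    forall p, aff (E e) o < aff (E e) p ->
      (forall f, aff (E f) o - gd.2 <= aff (E f) p) ->
    exists t, [/\ 0 <= t, t < 1, forall f, t * aff (E f) gd.1 <= aff (E f) p
      & aff (E e) o < t * aff (E e) gd.1]].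
Proof.
move=> pres; have o0 := pres_center pres.
have [x [ex fx]] := pres_facet pres e.
have [d d0 dx] : exists2 d, 0 < d &
    forall f, d <= aff (E f) o / (`|aff (E f) x - aff (E f) o| + 1).
  apply: finite_pos_lower_bound => f; apply: divr_gt0; first exact: o0.
  exact: ltr_wpDl.
pose g := o + d *: (o - x).
have gE f : aff (E f) g = (1 + d) * aff (E f) o - d * aff (E f) x.
  by rewrite /g /aff linD linZ linD linN; ring.
have g0 f : 0 <= aff (E f) g.
  have := dx f; rewrite ler_pdivlMr ?ltr_wpDl // => H.
  have H1 : d * (aff (E f) x - aff (E f) o) <=
            d * `|aff (E f) x - aff (E f) o|.
    by rewrite ler_pM2l // ler_norm.
  by rewrite gE; lra.
have eg : (1 + d) * aff (E e) o < aff (E e) g.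
  by rewrite gE ltrDl oppr_gt0 pmulr_rlt0.
have eg0 : 0 < aff (E e) g by apply: lt_trans eg; rewrite mulr_gt0 // addr_gt0.
have d1 : 0 < 1 + d by rewrite addr_gt0.
pose t0 := aff (E e) o / aff (E e) g.
(* Parameters above [t0] push the edge [e] of the copy past [o]; those below [(1 + d)^-1] leave
   slack in the other inequalities, measured by [c]. *)
pose t1 := (t0 + (1 + d)^-1) / 2.
have t02 : t0 < (1 + d)^-1.
  by rewrite ltr_pdivrMr // mulrC ltr_pdivlMr // mulrC.
have t0p : 0 < t0 by rewrite divr_gt0.
have t01 : t0 < t1 by rewrite /t1; lra.
have t12 : t1 * (1 + d) < 1.
  by rewrite -ltr_pdivlMr // div1r /t1; lra.
have t1lt1 : t1 < 1 by nra.
have [c c0 cP] : exists2 c, 0 < c &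
    forall f, c <= (1 - t1 * (1 + d)) * aff (E f) o.
  by apply: finite_pos_lower_bound => f; rewrite mulr_gt0 // subr_gt0.
exists (g, c); split => //=; first by apply/(pres_aff pres).
(* The largest parameter up to [t1] for which [p] meets the inequality [e]. *)
move=> p ep fp; pose t := Num.min t1 (aff (E e) p / aff (E e) g).
have t0t : t0 < t by rewrite lt_min t01 ltr_pM2r // invr_gt0.
have tt1 : t <= t1 by rewrite ge_min lexx.
exists t; split.
- exact: ltW (lt_trans t0p t0t).
- exact: le_lt_trans tt1 t1lt1.
- move=> f; have [->|fe] := eqVneq f e.
    by rewrite -ler_pdivlMr // ge_min lexx orbT.
  apply: le_trans (fp f); apply: (@le_trans _ _ (t1 * aff (E f) g)).
    by rewrite ler_wpM2r.
  have := cP f; have t10 : 0 <= t1 by exact: ltW (lt_trans t0p t01).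
  have : 0 <= t1 * (d * aff (E f) x).
    by apply: mulr_ge0 => //; apply: mulr_ge0; [exact: ltW|exact: fx].
  by rewrite gE; lra.
- by rewrite -ltr_pdivrMr.
Qed.

(** By [aff_le_eq], some edge form is larger at [p] than at [o]; the center belonging to that edge
    applies. *)
Lemma center_cover (R : realType) (C : set 'rV[R]_2) n
    (V : 'I_n -> 'rV[R]_2) k (E : 'I_k -> 'cV[R]_(2 + 1)) o :
  presentation C V E o ->
  exists (g : 'I_k -> 'rV[R]_2) (d : R), [/\ forall e, C (g e), 0 < d &
    forall p, p != o -> (forall f, `|aff (E f) p - aff (E f) o| <= d) ->
    exists e t, [/\ 0 <= t, t < 1, forall f, t * aff (E f) (g e) <= aff (E f) p
      & aff (E e) o < t * aff (E e) (g e)]].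
Proof.
move=> pres; have /choice[gd Hgd] := fun e => edge_center_cover e pres.
have [d d0 dP] : exists2 d, 0 < d & forall e, d <= (gd e).2.
  by apply: finite_pos_lower_bound => e; have [] := Hgd e.
exists (fun e => (gd e).1), d; split => //; first by move=> e; have [] := Hgd e.
move=> p po pd.
have Co : C o by apply/(pres_aff pres) => e; exact: ltW (pres_center pres e).
have [e ep] : exists e, aff (E e) o < aff (E e) p.
  apply: contrapT => noe; move/eqP: po; apply; apply: (aff_le_eq pres Co) => e.
  by rewrite leNgt; apply/negP => ep; apply: noe; exists e.
have [_ _ /(_ p ep)] := Hgd e; case.
  move=> f; have := pd f; have := dP e; rewrite ler_norml => H /andP[H1 _].
  by lra.
by move=> t Ht; exists e, t.
Qed.

(** * Covering a polygon minus a point *)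

Definition vertex_separated (R : realType) (C : set 'rV[R]_2)
    (g r p : 'rV[R]_2) : Prop :=
  exists t, [/\ 0 <= t, t < 1, nested_copy C 0 g 1 t p
    & ~ nested_copy C 0 g 1 t r].

(** If [u r < w i * u (V i)] for a test form [u], take [t] between [u r / u (V i)] and [w i]. The
    copy with center [V i] and parameter [t] contains the point, whose weight at [V i] exceeds [t],
    but misses [r], since [u] is at least [t * u (V i)] on it. *)
Lemma unseparated_weight_below (R : realType) (C : set 'rV[R]_2) n
    (V : 'I_n -> 'rV[R]_2) k (E : 'I_k -> 'cV[R]_(2 + 1)) o
    (r : 'rV[R]_2) (w : 'I_n -> R) (i : 'I_n) :
  presentation C V E o -> C r -> (forall j, 0 <= w j) -> \sum_j w j = 1 ->
  ~ vertex_separated C (V i) r (\sum_j w j *: V j) ->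
  weight_below C (V i) r (w i).
Proof.
move=> pres Cr w0 w1 nsep u uA u0.
have CV j : C (V j) by rewrite (pres_conv pres); exact: conv_points_vertex.
rewrite leNgt; apply/negP => ltu; apply: nsep.
have ur := u0 _ Cr.
have uV : 0 < u (V i).
  rewrite lt_neqAle u0 // andbT eq_sym; apply/eqP => uV.
  by move: ltu; rewrite uV mulr0 ltNge ur.
have wi1 : w i <= 1 by rewrite -w1 (bigD1 i) //= lerDl sumr_ge0.
pose t := (u r / u (V i) + w i) / 2.
have ltq : u r / u (V i) < w i by rewrite ltr_pdivrMr.
have q0 : 0 <= u r / u (V i) by rewrite divr_ge0 // ltW.
have t0 : 0 <= t by rewrite /t; lra.
have tw : t < w i by rewrite /t; lra.
have t1 : t < 1 by exact: lt_le_trans wi1.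
have ut : u r < t * u (V i) by rewrite -ltr_pdivrMr // /t; lra.
exists t; split => //.
  apply/(mem_nested_copy _ _ _ pres ltr01 t1) => e.
  have lV j : 0 <= aff (E e) (V j) by apply: (pres_aff pres _).1.
  have -> : aff (E e) (\sum_j w j *: V j) = \sum_j w j * aff (E e) (V j).
    by rewrite aff_sum w1 mul1r.
  have -> : aff (E e) 0 - 1 * dsubmx (E e) 0 0 = 0.
    by rewrite /aff /lin mul0mx mxE; ring.
  rewrite add0r mul1r; apply: (@le_trans _ _ (w i * aff (E e) (V i))).
    by rewrite ler_wpM2r // ltW.
  by rewrite (bigD1 i) //= lerDl sumr_ge0 // => j _; rewrite mulr_ge0.
move=> [x Cx rE]; move: ut; rewrite -rE add0r !mul1r addrC uA ltNge lerDl.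
by move/negP; apply; apply: mulr_ge0; [rewrite subr_ge0 ltW|exact: u0].
Qed.

(** Grid values descend from [m] in steps of [d * s], so their number depends on [K / d] only. The
    offset [j.+1] puts the value strictly below a positive [b]. *)
Lemma weight_grid (R : realType) (K d : R) : 0 < d ->
  exists J : nat, forall s m b : R,
    0 < s -> 0 <= b -> b <= m -> m <= b + K * s ->
  exists j : 'I_J,
    let a := Num.max 0 (m - j.+1%:R * (d * s)) in
    [/\ a <= b, b <= a + d * s & 0 < b -> a < b].
Proof.
move=> d0; exists (Num.truncn (K / d)).+1 => s m b s0 b0 bm mb.
have ds0 : 0 < d * s by rewrite mulr_gt0.
pose x := (m - b) / (d * s).
have x0 : 0 <= x by rewrite divr_ge0 ?subr_ge0 // ltW.
have xK : x <= K / d.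
  rewrite /x ler_pdivrMr // mulrA divfK ?gt_eqF //; lra.
have jP : (Num.truncn x < (Num.truncn (K / d)).+1)%N.
  by rewrite ltnS le_truncn.
have /andP[xl xu] := truncn_itv x0.
exists (Ordinal jP) => /=.
have mbE : m - b = x * (d * s) by rewrite divfK // gt_eqF.
have H1 : (Num.truncn x)%:R * (d * s) <= m - b by rewrite mbE ler_wpM2r // ltW.
have H2 : m - b < (Num.truncn x).+1%:R * (d * s) by rewrite mbE ltr_pM2r.
have H3 : (Num.truncn x).+1%:R * (d * s) =
    (Num.truncn x)%:R * (d * s) + d * s by rewrite -addn1 natrD; ring.
split.
- by rewrite ge_max b0 /=; lra.
- rewrite -lerBlDr le_max; apply/orP; right; lra.
- by move=> bp; rewrite gt_max bp /=; lra.
Qed.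

Lemma sum_dominated_eq (R : realType) n (w m : 'I_n -> R) :
  (forall i, w i <= m i) -> \sum_i m i <= \sum_i w i -> forall i, w i = m i.
Proof.
move=> wm Hsum i; apply/eqP; rewrite eq_le wm /=.
have : \sum_(j | j != i) w j <= \sum_(j | j != i) m j by apply: ler_sum.
by move: Hsum; rewrite (bigD1 i) //= [leRHS](bigD1 i) //=; lra.
Qed.

(** For [C] the hull of [V] and nonnegative [a] with sum below 1: the points with a convex
    representation whose weights are at least [a]. *)
Definition grid_copy (R : realType) (C : set 'rV[R]_2) n
    (V : 'I_n -> 'rV[R]_2) (a : 'I_n -> R) : set 'rV[R]_2 :=
  [set (1 - \sum_i a i) *: x + \sum_i a i *: V i | x in C].

(** If neither vertices nor grid separate [p] from [r], both lie in a grid copy so small relative to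
    [s] that [center_cover], scaled by [s] and moved from [o] to [r], separates them. *)
Lemma point_cover_cases (R : realType) (C : set 'rV[R]_2) n
    (V : 'I_n -> 'rV[R]_2) k (E : 'I_k -> 'cV[R]_(2 + 1)) o :
  presentation C V E o ->
  exists (J : nat) (g : 'I_k -> 'rV[R]_2), (forall e, C (g e)) /\
  forall r, C r -> exists (s : R) (a : {ffun 'I_n -> 'I_J} -> 'I_n -> R),
    [/\ 0 <= s, forall e, s * aff (E e) o <= aff (E e) r,
        forall j i, 0 <= a j i
      & forall p, C p -> p != r ->
        [\/ exists i, vertex_separated C (V i) r p,
            exists j, [/\ \sum_i a j i < 1, grid_copy C V (a j) p
              & ~ grid_copy C V (a j) r]
          | 0 < s /\ exists e t, [/\ 0 <= t, t < 1,
              nested_copy C (r - s *: o) (g e) s t p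
              & ~ nested_copy C (r - s *: o) (g e) s t r]]].
Proof.
move=> pres.
have CV j : C (V j) by rewrite (pres_conv pres); exact: conv_points_vertex.
have [K K0 HK] := weight_below_depth pres.
have [g [eps [Cg eps0 Hg]]] := center_cover pres.
have [B B0 HB] := presentation_aff_bounded pres.
(* A grid copy of ratio at most [n%:R * (d * s)] then varies by at most [eps * s] in each edge form;
   [n.+1] keeps the denominator positive. *)
pose d := eps / (n.+1%:R * B).
have nB0 : 0 < n.+1%:R * B by rewrite mulr_gt0 // ltr0n.
have d0 : 0 < d by rewrite divr_gt0.
have [J HJ] := weight_grid K d0.
exists J, g; split => // r Cr.
have [s [m [s0 sr msum mP]]] := HK r Cr.
pose a (j : {ffun 'I_n -> 'I_J}) i := Num.max 0 (m i - (j i).+1%:R * (d * s)).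
exists s, a; split => //; first by move=> j i; rewrite le_max lexx.
move=> p Cp pr; apply: contrapT => Hn.
have nsep i : ~ vertex_separated C (V i) r p.
  by move=> Hi; apply: Hn; apply: Or31; exists i.
move: Cp; rewrite (pres_conv pres) => -[w [w0 w1 pE]].
have wm i : w i <= m i.
  apply: mP; apply: (unseparated_weight_below pres) => //.
  by rewrite -pE.
(* At depth 0 the bounds [m] sum to at most 1, so the weights of both [p] and [r] equal [m]. *)
move: s0; rewrite le_eqVlt => /predU1P[s0|s0].
  have : conv_points V r by rewrite -(pres_conv pres).
  move=> -[v [v0 v1 rE]].
  have vm i : v i <= m i.
    apply: mP; apply: (unseparated_weight_below pres) => //.
    by rewrite -rE => -[t [_ _]].
  move/eqP: pr; apply; rewrite pE rE; apply: eq_bigr => i _.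
  rewrite -s0 mulr0 addr0 in msum.
  rewrite (sum_dominated_eq wm) ?w1 //.
  by rewrite (sum_dominated_eq vm) ?v1.
(* The gaps [m i - w i] are nonnegative with sum at most [K * s]. *)
have mw i : m i <= w i + K * s.
  have : \sum_(j | j != i) w j <= \sum_(j | j != i) m j by apply: ler_sum.
  move: msum; rewrite -w1 (bigD1 i) //= [X in _ <= X + _ -> _](bigD1 i) //=.
  by lra.
have /choice[j0 Hj0] := fun i => HJ s (m i) (w i) s0 (w0 i) (wm i) (mw i).
pose j := [ffun i => j0 i].
have aw i : a j i <= w i by rewrite /a ffunE; case: (Hj0 i).
have wa i : w i <= a j i + d * s by rewrite /a ffunE; case: (Hj0 i).
have aw_lt i : 0 < w i -> a j i < w i by rewrite /a ffunE; case: (Hj0 i).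
have a1 : \sum_i a j i < 1.
  have le1 : \sum_i a j i <= 1 by rewrite -w1; apply: ler_sum.
  (* Sum 1 would force [a j] to equal [w], and by strictness all weights would vanish. *)
  rewrite lt_neqAle le1 andbT; apply/eqP => aE.
  have wE i : w i = 0.
    apply/eqP; rewrite eq_le w0 andbT leNgt; apply/negP => /aw_lt.
    by rewrite (sum_dominated_eq aw) ?ltxx // aE w1.
  by have := oner_neq0 R; rewrite -w1 big1 ?eqxx.
set l := 1 - \sum_i a j i.
have l0 : 0 < l by rewrite subr_gt0.
have lE : l <= n%:R * (d * s).
  have -> : l = \sum_i (w i - a j i) by rewrite sumrB w1.
  rewrite mulr_natl -[in leRHS](card_ord n) -sumr_const.
  by apply: ler_sum => i _; rewrite lerBlDl.
have thr e : aff (E e) (\sum_i a j i *: V i) - l * dsubmx (E e) 0 0 =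
    \sum_i a j i * aff (E e) (V i).
  by rewrite aff_sum /aff /l; ring.
have Gp : grid_copy C V (a j) p.
  apply/(mem_copy _ _ pres l0) => e; rewrite thr.
  have -> : aff (E e) p = \sum_i w i * aff (E e) (V i).
    by rewrite aff_sum w1 mul1r -pE.
  apply: ler_sum => i _; rewrite ler_wpM2r //.
  by apply: (pres_aff pres _).1.
have Gr : grid_copy C V (a j) r.
  by apply: contrapT => Gr; apply: Hn; apply: Or32; exists j.
have close f : `|aff (E f) p - aff (E f) r| <= eps * s.
  case: Gp Gr => x Cx <- [y Cy <-].
  have -> : aff (E f) (l *: x + \sum_i a j i *: V i) -
            aff (E f) (l *: y + \sum_i a j i *: V i) =
            l * (aff (E f) x - aff (E f) y).
    by rewrite /aff !linD !linZ; ring.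
  rewrite normrM gtr0_norm //.
  have xy : `|aff (E f) x - aff (E f) y| <= B.
    have x0 : 0 <= aff (E f) x by apply: (pres_aff pres _).1.
    have y0 : 0 <= aff (E f) y by apply: (pres_aff pres _).1.
    have := HB _ f Cx; have := HB _ f Cy.
    by rewrite ler_norml => *; apply/andP; split; lra.
  apply: le_trans (ler_pM (ltW l0) (normr_ge0 _) lE xy) _.
  have -> : eps * s = n.+1%:R * (d * s) * B.
    by rewrite /d; field; rewrite nat1r gt_eqF // gt_eqF // ltr0n.
  by rewrite ler_wpM2r ?ler_wpM2r ?ler_nat // ltW // mulr_gt0.
have sn0 : s != 0 by rewrite gt_eqF.
(* The homothety of ratio [s^-1] that takes [r] to [o]. *)
pose p' := o + s^-1 *: (p - r).
have p'E f : s * (aff (E f) p' - aff (E f) o) = aff (E f) p - aff (E f) r.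
  by rewrite /p' /aff !(linD, linZ, linN); field.
have [||e [t [t0 t1 Ht Hot]]] := Hg p'.
- apply: contra pr; rewrite -subr_eq0 [p' - o]addrC addKr scaler_eq0.
  by rewrite invr_eq0 (negPf sn0) subr_eq0.
- move=> f; rewrite -(ler_pM2l s0) -{1}(gtr0_norm s0) -normrM p'E mulrC.
  by rewrite close.
apply: Hn; apply: Or33; split => //; exists e, t.
have base f : aff (E f) (r - s *: o) - s * dsubmx (E f) 0 0 =
    aff (E f) r - s * aff (E f) o.
  by rewrite /aff linD linN linZ; ring.
split => //.
  apply/(mem_nested_copy _ _ _ pres s0 t1) => f; rewrite base.
  have := p'E f; have : s * (t * aff (E f) (g e)) <= s * aff (E f) p'.
    by rewrite ler_pM2l.
  by lra.
move/(mem_nested_copy _ _ _ pres s0 t1)/(_ e); rewrite base.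
have : s * aff (E e) o < s * (t * aff (E e) (g e)) by rewrite ltr_pM2l.
by lra.
Qed.

Lemma self_coverable1 (R : realType) (C : set 'rV[R]_2) :
  convex_polygon C -> exists I : finType, self_coverable C I 1.
Proof.
move=> /convex_polygon_presentation[n [V [k [E [z pres]]]]].
have [J [g [Cg HJ]]] := point_cover_cases pres.
(* One copy per vertex, per choice of grid values and per edge. *)
exists ('I_n + {ffun 'I_n -> 'I_J} + 'I_k)%type => B P B1 PC.
have CV i : C (V i) by rewrite (pres_conv pres); exact: conv_points_vertex.
have trivial_cover : (forall p, p \in B -> ~ C p) ->
    exists D : 'I_n + {ffun 'I_n -> 'I_J} + 'I_k -> set 'rV[R]_2,
    [/\ forall i, D i `<=` C, forall i, D i = set0 \/ homothetic_copy C (D i),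
        forall i p, p \in B -> ~ D i p & forall p, p \in P -> exists i, D i p].
  move=> BC; exists (fun=> C); split => //.
  - by move=> _; exact: subset_refl.
  - by move=> _; right; exact: homothetic_copy_refl.
  - move=> p /PC[Cp _].
    (* Weights summing to 1 show that there is a vertex to serve as index. *)
    have [w [_ w1 _]] : conv_points V p by rewrite -(pres_conv pres).
    have [i _|noi] := pickP (fun _ : 'I_n => true); first by exists (inl (inl i)).
    by move: w1; rewrite big_pred0 // => /eqP; rewrite eq_sym oner_eq0.
case: B B1 PC trivial_cover => [_ _|r [|//] _ PC]; first exact.
have [Cr _|nCr] := pselect (C r); last first.
  by apply=> p; rewrite mem_seq1 => /eqP ->.
have [s [a [s0 sr a0 Hcases]]] := HJ r Cr.
pose sub Q := [seq p <- P | `[< Q p >]].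
have subP Q p : p \in sub Q -> Q p by rewrite mem_filter => /andP[/asboolP].
have memsub (Q : set 'rV[R]_2) p : p \in P -> Q p -> p \in sub Q.
  by move=> pP Qp; rewrite mem_filter pP andbT; apply/asboolP.
have /choice[F1 HF1] : forall i, exists F : set 'rV[R]_2,
    [/\ F `<=` C, F = set0 \/ homothetic_copy C F, ~ F r
      & forall p, p \in sub (vertex_separated C (V i) r) -> F p].
  move=> i; apply: (nested_copies_cover (q := 0) pres ltr01 _ (CV i)) => [e|p /subP //].
  by rewrite /aff /lin mul0mx mxE add0r mul1r subrr.
(* The conditions on [a j] empty the set when the grid copy is degenerate or contains [r]. *)
pose F2 j := [set x | [/\ \sum_i a j i < 1, grid_copy C V (a j) x
                       & ~ grid_copy C V (a j) r]].
have HF2 j : [/\ F2 j `<=` C, F2 j = set0 \/ homothetic_copy C (F2 j)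
               & ~ F2 j r].
  split; last by case.
    move=> x [aj1 + _]; apply: (copy_sub pres); first by rewrite subr_gt0.
    move=> e; have -> : aff (E e) (\sum_i a j i *: V i) -
        (1 - \sum_i a j i) * dsubmx (E e) 0 0 = \sum_i a j i * aff (E e) (V i).
      by rewrite aff_sum /aff; ring.
    by apply: sumr_ge0 => i _; rewrite mulr_ge0 //; apply: (pres_aff pres _).1.
  have [[aj1 nr]|H] :=
    pselect (\sum_i a j i < 1 /\ ~ grid_copy C V (a j) r); [right|left].
    exists (1 - \sum_i a j i), (\sum_i a j i *: V i); rewrite subr_gt0.
    by split => //; apply/seteqP; split => [x []|x Gx].
  by apply/seteqP; split => // x [aj1 _ nr]; case: H.
have /choice[F3 HF3] : forall e, exists F : set 'rV[R]_2,
    [/\ F `<=` C, F = set0 \/ homothetic_copy C F, ~ F r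
      & forall p, p \in sub (fun p => 0 < s /\ exists t, [/\ 0 <= t, t < 1,
              nested_copy C (r - s *: z) (g e) s t p
              & ~ nested_copy C (r - s *: z) (g e) s t r]) -> F p].
  move=> e; move: s0; rewrite le_eqVlt => /predU1P[s0|s0].
    exists set0; split => //; first by left.
    by move=> p /subP[]; rewrite -s0 ltxx.
  apply: (nested_copies_cover (q := r - s *: z) pres s0 _ (Cg e)) => [f|p /subP[]//].
  have := sr f; rewrite -subr_ge0 => /le_trans; apply.
  by rewrite /aff linD linN linZ; lra.
exists (fun i => match i with
  | inl (inl i) => F1 i | inl (inr j) => F2 j | inr e => F3 e end); split.
- by move=> [[i|j]|e]; [case: (HF1 i)|case: (HF2 j)|case: (HF3 e)].
- by move=> [[i|j]|e]; [case: (HF1 i)|case: (HF2 j)|case: (HF3 e)].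
- move=> i p; rewrite mem_seq1 => /eqP ->.
  by case: i => [[i|j]|e]; [case: (HF1 i)|case: (HF2 j)|case: (HF3 e)].
- move=> p pP; have [Cp] := PC p pP; rewrite mem_seq1 => pr.
  have [[i Hi]|[j Hj]|[s1 [e Ht]]] := Hcases p Cp pr.
  + by exists (inl (inl i)); have [_ _ _] := HF1 i; apply; exact: memsub.
  + by exists (inl (inr j)).
  + by exists (inr e); have [_ _ _] := HF3 e; apply; exact: memsub.
Qed.

Theorem corollary4 (R : realType) (C : set 'rV[R]_2) (hC : convex_polygon C) :
  exists d : nat,
    (exists m : nat, polychromatic_colorable C 2 m) ->
    forall k : nat, (0 < k)%N -> polychromatic_colorable C k (k ^ d)%N.
Proof.
by have [I /self_coverable_polychromatic] := self_coverable1 hC.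
Qed.
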